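(* Let $t\in\mathbb{N}$, and let $\mathcal{Y}$ be the $t$-intersection of the class of complete multipartite graphs. Then $\mathcal{Y}$ is linearly $\chi$-bounded with $\chi$-binding function $h(x)=t^{2^t}\cdot x$.
   Context: All graphs are finite and simple. A complete multipartite graph is the complement of an equivalence graph (a graph each of whose connected components is complete). For graphs $H_1,\dots,H_t$ on a common vertex set $V$, $H_1\wedge\cdots\wedge H_t$ is the graph on $V$ whose edge set is the intersection of their edge sets. The $t$-intersection of a class $\mathcal{X}$ is the class of all graphs $H_1\wedge\cdots\wedge H_t$ with $H_1,\dots,H_t\in\mathcal{X}$ on a common vertex set. A class is $\chi$-bounded with $\chi$-binding function $h$ if $\chi(H)\le h(\omega(H))$ for every induced subgraph $H$ of every graph in the class ($\chi$ = chromatic number, $\omega$ = clique number); it is linearly $\chi$-bounded if $h$ can be taken linear. *)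

(* Defs.v *)
From mathcomp Require Import all_boot.

Set Implicit Arguments.
Unset Strict Implicit.
Unset Printing Implicit Defensive.

Record graph (V : finType) := Graph {
  adj :> rel V;
  adj_sym : symmetric adj;
  adj_irrefl : irreflexive adj }.

(* Membership in the classes below only depends on the adjacency relation up
   to extensional equality, so that the proof fields of graph play no role. *)
Definition graph_class := forall V : finType, graph V -> Prop.

Section Operations.
Variable V : finType.
Implicit Types (G : graph V) (A : {set V}).

Definition compl_rel G : rel V := fun x y => (x != y) && ~~ G x y.

Lemma compl_sym G : symmetric (compl_rel G).
Proof. by move=> x y; rewrite /compl_rel eq_sym adj_sym. Qed.

Lemma compl_irrefl G : irreflexive (compl_rel G).
Proof. by move=> x; rewrite /compl_rel eqxx. Qed.

Definition compl G : graph V := Graph (compl_sym G) (compl_irrefl G).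

(* The test x != y only matters for the empty family (t = 0), whose
   intersection is the complete graph. *)
Definition meet_rel t (H : 'I_t -> graph V) : rel V :=
  fun x y => (x != y) && [forall i, H i x y].

Lemma meet_sym t (H : 'I_t -> graph V) : symmetric (meet_rel H).
Proof.
move=> x y; rewrite /meet_rel eq_sym; congr andb.
by apply: eq_forallb => i; rewrite adj_sym.
Qed.

Lemma meet_irrefl t (H : 'I_t -> graph V) : irreflexive (meet_rel H).
Proof. by move=> x; rewrite /meet_rel eqxx. Qed.

Definition meet t (H : 'I_t -> graph V) : graph V :=
  Graph (meet_sym H) (meet_irrefl H).

Definition induced_rel G A : rel {x : V | x \in A} :=
  fun x y => G (val x) (val y).

Lemma induced_sym G A : symmetric (@induced_rel G A).
Proof. by move=> x y; rewrite /induced_rel adj_sym. Qed.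

Lemma induced_irrefl G A : irreflexive (@induced_rel G A).
Proof. by move=> x; rewrite /induced_rel adj_irrefl. Qed.

Definition induced G A : graph {x : V | x \in A} :=
  Graph (@induced_sym G A) (@induced_irrefl G A).

Definition clique G A : bool :=
  [forall x in A, forall y in A, (x != y) ==> G x y].

Definition clique_number G : nat := \max_(A : {set V} | clique G A) #|A|.

Definition colorable G (k : nat) : bool :=
  [exists c : {ffun V -> 'I_k}, forall x, forall y, G x y ==> (c x != c y)].

Lemma ex_colorable G : exists k, colorable G k.
Proof.
exists #|V|; apply/existsP; exists [ffun x => enum_rank x].
apply/forallP => x; apply/forallP => y; apply/implyP => xy.
rewrite !ffunE; apply: contraTneq xy => /enum_rank_inj ->.
by rewrite adj_irrefl.
Qed.

Definition chromatic_number G : nat := ex_minn (ex_colorable G).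

Definition component G (x : V) : {set V} := [set y | connect G x y].

Definition equivalence_graph G : Prop := forall x, clique G (component G x).

End Operations.

Definition complete_multipartite : graph_class := fun V G =>
  exists E : graph V, equivalence_graph E /\ G =2 compl E.

Definition intersection_class (t : nat) (X : graph_class) : graph_class :=
  fun V G => exists H : 'I_t -> graph V, (forall i, X V (H i)) /\ G =2 meet H.

Definition chi_binding (X : graph_class) (h : nat -> nat) : Prop :=
  forall (V : finType) (G : graph V), X V G ->
  forall A : {set V},
    chromatic_number (induced G A) <= h (clique_number (induced G A)).

Definition linearly_chi_bounded (X : graph_class) : Prop :=
  exists c : nat, chi_binding X (fun x => c * x).

(* Main.v *)
Require Import Defs.
From mathcomp Require Import all_boot.

(** A graph in the class is given by [t] equivalence relations on its vertices,
    two vertices being adjacent when no relation relates them.  Every vertex is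
    thus related to some member [k] of a maximal clique by some relation [i],
    and the vertices sharing a pair [(k, i)] form a stable set.  Hence
    [chi <= t * omega], which is stronger than the stated bound. *)

Section Graphs.
Variable V : finType.
Implicit Types (G : graph V) (K : {set V}).

Lemma chromatic_number_le_card G (C : finType) (c : V -> C) :
  (forall x y, G x y -> c x != c y) -> chromatic_number G <= #|C|.
Proof.
move=> c_proper; rewrite /chromatic_number.
case: ex_minnP => k _; apply; apply/existsP.
exists [ffun x => enum_rank (c x)].
apply/forallP => x; apply/forallP => y; apply/implyP => /c_proper.
by rewrite !ffunE (inj_eq enum_rank_inj).
Qed.

Lemma cliqueP G K :
  reflect {in K &, forall x y, x != y -> G x y} (clique G K).
Proof.
apply: (iffP forall_inP) => [cK x y xK yK | cK x xK].
  by move/forall_inP: (cK x xK) => /(_ y yK) /implyP.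
by apply/forall_inP => y yK; apply/implyP; apply: cK.
Qed.

(** An inclusion-maximal clique works: a vertex adjacent to all its members could be added, so it
    would already be a member and carry a loop. *)
Lemma dominating_clique G :
  exists2 K, clique G K & forall x, exists2 k, k \in K & ~~ G k x.
Proof.
have [|K /maxsetP[cK maxK]] := ex_maxset (P := clique G).
  by exists set0; apply/cliqueP => x y; rewrite inE.
exists K => // x; apply/exists_inP; rewrite -[X in is_true X]negbK.
rewrite negb_exists_in; apply/negP => /forall_inP domx.
have {}domx k : k \in K -> G k x by move/domx; rewrite negbK.
have cxK : clique G (x |: K).
  apply/cliqueP => y z /setU1P[-> | yK] /setU1P[-> | zK]; rewrite ?eqxx //.
  - by rewrite adj_sym => _; apply: domx.
  - by move=> _; apply: domx.
  - by move/cliqueP: cK; apply.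
have xK : x \in K by rewrite -(maxK _ cxK (subsetUr _ _)) setU11.
by have := domx x xK; rewrite adj_irrefl.
Qed.

Lemma chromatic_number_le_equivalences G t (r : 'I_t -> rel V) :
  (forall i, left_transitive (r i)) ->
  (forall x y, G x y = [forall i, ~~ r i x y]) ->
  chromatic_number G <= t * clique_number G.
Proof.
move=> r_trans G_def; have [K cK domK] := dominating_clique G.
have related x : exists p : {k | k \in K} * 'I_t, r p.2 (val p.1) x.
  have [k kK] := domK x; rewrite G_def negb_forall => /existsP[i].
  by rewrite negbK => rkx; exists (Sub k kK, i).
(* The chosen pair serves as the colour of [x]. *)
have [c c_related] := fin_all_exists related.
apply: (@leq_trans (t * #|K|)); last first.
  by rewrite leq_mul2l (@leq_bigmax_cond _ _ (fun A : {set V} => #|A|)) ?orbT.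
have -> : t * #|K| = #|{: {k | k \in K} * 'I_t}|.
  by rewrite card_prod card_sig card_ord mulnC.
apply: (@chromatic_number_le_card _ _ c) => x y.
rewrite G_def; apply: contraL => /eqP cxy.
(* With equal colours, one relation relates the same clique member to [x] and to [y]; left
   transitivity then relates [x] to [y]. *)
have := c_related y; rewrite -cxy (r_trans _ _ _ (c_related x)) => rxy.
by rewrite negb_forall; apply/existsP; exists (c x).2; rewrite negbK.
Qed.

(** Two neighbours of a vertex lie in its component, which is a clique, so they are equal or
    adjacent. *)
Lemma equivalence_graph_left_transitive G :
  equivalence_graph G -> left_transitive (fun x y => (x == y) || G x y).
Proof.
move=> eqG.
have trG x y z : G x y -> G x z -> (y == z) || G y z.
  move=> Gxy Gxz; case: eqP => //= /eqP yz.
  by move/cliqueP: (eqG x); apply; rewrite // inE connect1.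
move=> x y /orP[/eqP-> // | Gxy] z; have Gyx : G y x by rewrite adj_sym.
apply/idP/idP => /orP[/eqP<- | Gz]; rewrite ?Gxy ?Gyx ?orbT //.
  exact: trG Gz.
exact: trG Gz.
Qed.

End Graphs.

Lemma complete_multipartite_intersection_chi_binding t : 0 < t ->
  chi_binding (intersection_class t complete_multipartite) (muln t).
Proof.
move=> t_gt0 V G [H [H_cm G_meet]] A.
have [E E_spec] := fin_all_exists H_cm.
pose r i (x y : {x | x \in A}) := (val x == val y) || E i (val x) (val y).
apply: (@chromatic_number_le_equivalences _ _ _ r) => [i x y rxy z | x y].
  have [eqE _] := E_spec i.
  exact: (equivalence_graph_left_transitive _ _ eqE _ _ rxy).
rewrite [LHS]G_meet /= /meet_rel.
have -> : [forall i, H i (val x) (val y)] = [forall i, ~~ r i x y].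
  by apply: eq_forallb => i; rewrite (E_spec i).2 /= /compl_rel /r negb_or.
(* Only the diagonal remains: each [r i] is reflexive, and [0 < t] supplies an index at which the
   universal statement fails. *)
have [xy|//] := eqVneq (val x) (val y); symmetry; apply/forallP => /=.
by move/(_ (Ordinal t_gt0)); rewrite /r xy eqxx.
Qed.

Theorem theorem5p26 (t : nat) (ht : 0 < t) :
  linearly_chi_bounded (intersection_class t complete_multipartite) /\
  chi_binding (intersection_class t complete_multipartite)
    (fun x : nat => t ^ (2 ^ t) * x).
Proof.
have bind_t := complete_multipartite_intersection_chi_binding t ht.
split; first by exists t.
move=> V G XG A; apply: leq_trans (bind_t V G XG A) _.
(* The factor [t] is [t ^ 1], and [1 <= 2 ^ t]. *)
by rewrite leq_mul2r -{1}(expn1 t) leq_pexp2l ?orbT // expn_gt0.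
Qed.
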